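(* Let $h\ge 1$ and $n>2h$ be integers, let $\{w_{-h},\dots,w_0,\dots,w_h\}$ be a symmetric filter (real weights with $w_{-d}=w_d$), let $\mathbf{S}$ be an $n\times n$ smoothing matrix associated with this filter, and let $\mathbf{W}$ be the corresponding $n\times n$ circulant matrix. Then for every $\lambda\in\sigma(\mathbf{S})$ there exists $i\in\{1,2,\dots,n\}$ such that $$\left|\lambda-\left(\sum_{d=0}^h w_d\,\omega^{(i-1)d}+\sum_{d=-h}^{-1}w_d\,\omega^{(i-1)(n+d)}\right)\right|\leq\delta_W,$$ where $\omega=e^{-\imath\frac{2\pi}{n}}$, $\imath$ is the imaginary unit, and $\delta_W=\|\mathbf{S}-\mathbf{W}\|_2$.
   Context: $\sigma(\mathbf{A})$ denotes the set of (complex) eigenvalues of a square matrix $\mathbf{A}$, and $\|\mathbf{A}\|_2=\sqrt{\rho(\mathbf{A}'\mathbf{A})}$, where $\mathbf{A}'$ is the transpose and $\rho$ is the spectral radius (maximum modulus of the eigenvalues). Smoothing matrix: an $n\times n$ smoothing matrix associated with the symmetric filter $\{w_{-h},\dots,w_h\}$ is a real matrix $\mathbf{S}=(s_{tj})$ such that: (i) for $t=h+1,\dots,n-h$, row $t$ carries the symmetric filter centred at $t$, i.e. $s_{tj}=w_{j-t}$ if $|j-t|\le h$ and $s_{tj}=0$ otherwise; (ii) the first $h$ rows have nonzero entries only in the first $2h$ columns, and the last $h$ rows have nonzero entries only in the last $2h$ columns (these rows contain the weights of arbitrary asymmetric filters used at the boundaries); (iii) $\mathbf{S}$ is centrosymmetric: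 $s_{tj}=s_{n+1-t,\,n+1-j}$ for all $t,j$. Corresponding circulant matrix: $\mathbf{W}=\sum_{d=0}^h w_d\mathbf{C}^d+\sum_{d=-h}^{-1}w_d\mathbf{C}^{n+d}$, where $\mathbf{C}$ is the $n\times n$ circulant matrix whose first row is $[0,1,0,\dots,0]$ (each subsequent row being the previous one cyclically shifted one place to the right). *)

(* Defs.v *)
From mathcomp Require Export all_boot all_order all_algebra.
From mathcomp Require Export all_classical all_reals all_analysis.
From mathcomp Require Export complex.

Set Implicit Arguments.
Unset Strict Implicit.
Unset Printing Implicit Defensive.

Import Order.TTheory GRing.Theory Num.Theory.

Local Open Scope ring_scope.
Local Open Scope complex_scope.

Definition cexp (R : realType) (z : R[i]) : R[i] :=
  (expR (complex.Re z))%:C * (cos (complex.Im z) +i* sin (complex.Im z)).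

Definition omega (R : realType) (n : nat) : R[i] :=
  cexp (- ('i * (2 * pi / n%:R)%:C)).

(* The set of eigenvalues is finite, and nonempty for n > 0, so this supremum
   is a maximum. *)
Definition spectral_radius (R : realType) (n : nat) (A : 'M[R[i]]_n) : R :=
  sup [set complex.Re `|z| | z in [set z : R[i] | eigenvalue A z]]%classic.

Definition norm2 (R : realType) (n : nat) (A : 'M[R]_n) : R :=
  Num.sqrt (spectral_radius (map_mx (real_complex R) (A^T *m A))).

(* A filter w_{-h}, ..., w_h is given by a function on int; only its values on
   [-h, h] are used. *)
Definition symmetric_filter (R : realType) (h : nat) (w : int -> R) : Prop :=
  forall d : int, `|d| <= h%:Z -> w (- d) = w d.

(* Rows and columns are numbered from 0: the interior rows h+1, ..., n-h of the
   1-based numbering are those with h <= t < n - h. *)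
Definition smoothing_matrix (R : realType) (n h : nat) (w : int -> R)
    (S : 'M[R]_n) : Prop :=
  [/\ forall t j : 'I_n, (h <= t < n - h)%N ->
        S t j = if `|j%:Z - t%:Z| <= h%:Z then w (j%:Z - t%:Z) else 0,
      forall t j : 'I_n, (t < h)%N -> (2 * h <= j)%N -> S t j = 0,
      forall t j : 'I_n, (n - h <= t)%N -> (j < n - 2 * h)%N -> S t j = 0
    & forall t j : 'I_n, S t j = S (rev_ord t) (rev_ord j)].

(* [ordS] is the successor modulo n. *)
Definition shift_mx (R : realType) (n : nat) : 'M[R]_n :=
  \matrix_(i, j) (j == ordS i)%:R.

(* The sum over d = -h, ..., -1 is indexed by k = -d. *)
Definition circulant_mx (R : realType) (n h : nat) (w : int -> R) : 'M[R]_n :=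
  \sum_(0 <= d < h.+1) w d%:Z *: shift_mx R n ^+ d
  + \sum_(1 <= k < h.+1) w (- k%:Z) *: shift_mx R n ^+ (n - k).

(* Main.v *)
(* Bauer-Fike for a normal matrix: the shift matrix C is a permutation matrix,
   hence unitarily diagonalisable, and C^n = 1 forces its eigenvalues to be
   powers of omega. As W = p(C), the same unitary basis diagonalises W with
   entries p(omega^k). If v S = lambda v, then v (S - W) = v (lambda - W) has
   norm at least min_k |lambda - p(omega^k)| |v| and at most |S - W|_2 |v|. *)

Require Import Defs.
From mathcomp Require Import spectral perm ring lra.
Import Order.TTheory GRing.Theory Num.Theory.
Local Open Scope ring_scope.
Local Open Scope complex_scope.
Local Open Scope sesquilinear_scope.

Lemma dotmx_sum (C : numClosedFieldType) n (u v : 'rV[C]_n) :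
  dotmx u v = \sum_i u 0 i * (v 0 i)^*%R.
Proof. by rewrite dotmxE mxE; apply: eq_bigr => i _; rewrite !mxE. Qed.

Lemma dotmx_unitary (C : numClosedFieldType) n (P : 'M[C]_n) (u v : 'rV[C]_n) :
  P \is unitarymx -> dotmx (u *m P) (v *m P) = dotmx u v.
Proof.
move=> uP; rewrite !dotmxE trmx_mul map_mxM mulmxA -[_ *m P *m _]mulmxA.
by rewrite (unitarymxP uP) mulmx1.
Qed.

Lemma eigenvalue_diag (C : numClosedFieldType) n (P : 'M[C]_n) (d : 'rV[C]_n) i :
  P \in unitmx -> eigenvalue (invmx P *m diag_mx d *m P) (d 0 i).
Proof.
move=> uP; apply/eigenvalueP; exists (delta_mx 0 i *m P).
  rewrite !mulmxA mulmxK// scalemxAl; congr (_ *m _).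
  rewrite -rowE row_diag_mx; apply/rowP => j; rewrite !mxE.
  by rewrite eqxx.
apply/eqP => /(congr1 (mulmx^~ (invmx P))); rewrite mulmxK// mul0mx.
move=> /matrixP/(_ 0 i); rewrite !mxE !eqxx => /eqP.
by rewrite oner_eq0.
Qed.

(** If [v] is a left eigenvector of [A *m B], then [v *m A] is one of [B *m A]. It is nonzero
    because multiplying it by [B] gives [a *: v], with [a != 0]. *)
Lemma eigenvalue_mulmxC (F : fieldType) n (A B : 'M[F]_n) a :
  a != 0 -> eigenvalue (A *m B) a -> eigenvalue (B *m A) a.
Proof.
move=> a0 /eigenvalueP[v vAB v0]; apply/eigenvalueP; exists (v *m A).
  by rewrite !mulmxA -[v *m A *m B]mulmxA vAB scalemxAl.
apply: contraNneq v0 => vA0; move: vAB; rewrite mulmxA vA0 mul0mx.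
by move=> /esym/eqP; rewrite scaler_eq0 (negPf a0).
Qed.

(** A [sup] dominates its set only if the set is bounded above. Eigenvalues are roots of
    [char_poly A], so the sum of the moduli of all its roots is such a bound. *)
Lemma spectral_radius_ge (R : realType) n (A : 'M[R[i]]_n) a :
  eigenvalue A a -> `|a| <= (spectral_radius A)%:C.
Proof.
move=> eA; rewrite -[`|a|]RRe_real ?normr_real// lecR.
apply: ub_le_sup; last by exists a.
have [r rE] := closed_field_poly_normal (char_poly A).
exists (\sum_(z <- r) complex.Re `|z|) => _ [z /= zA <-].
have zr : z \in r.
  move: zA; rewrite eigenvalue_root_char rE (monicP (char_poly_monic A)).
  by rewrite scale1r root_prod_XsubC.
rewrite (big_rem _ zr)/= lerDl sumr_ge0// => x _.
by case: x => x y; apply: sqrtr_ge0.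
Qed.

(** With vectors acting from the left, the squared length of [v *m A] is the Hermitian form of
    [A *m A^T] at [v], while [norm2] is defined from [A^T *m A]. So [A *m A^T] is diagonalised, and
    its eigenvalues are compared with those of the other product. *)
Lemma dotmx_mulmx_norm2 (R : realType) n (A : 'M[R]_n) (v : 'rV[R[i]]_n) :
  dotmx (v *m map_mx (real_complex R) A) (v *m map_mx (real_complex R) A) <=
    (norm2 A ^+ 2)%:C * dotmx v v.
Proof.
pose A' := map_mx (real_complex R) A; have A't : A' ^t* = A'^T.
  by apply/matrixP => i j; rewrite !mxE; apply: conjc_real.
set B := A' *m A'^T.
have Bh : B \is hermsymmx.
  apply/is_hermitianmxP; rewrite expr0 scale1r.
  by rewrite /B -A't trmx_mul map_mxM trmxCK.
pose P := spectralmx B; pose e := spectral_diag B.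
have uP : P \is unitarymx := spectral_unitarymx B.
have BE : B = invmx P *m diag_mx e *m P := orthomx_spectralP (hermitian_normalmx Bh).
pose rho := spectral_radius (map_mx (real_complex R) (A^T *m A)).
have e_le i : `|e 0 i| <= rho%:C.
  have eB : eigenvalue B (e 0 i).
    by rewrite BE; apply: eigenvalue_diag; apply: unitarymx_unit.
  (* Only nonzero eigenvalues transfer from A A^T to A^T A. *)
  have [e0|e0] := eqVneq (e 0 i) 0; last first.
    apply: spectral_radius_ge; rewrite map_mxM -map_trmx.
    exact: eigenvalue_mulmxC.
  (* For a zero entry the claim is [0 <= rho]; any eigenvalue gives this, and one exists because the
     index [i] forces [0 < n]. *)
  have [a aP] := eigenvalue_closed (map_mx (real_complex R) (A^T *m A))
    (leq_ltn_trans (leq0n i) (ltn_ord i)).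
  by rewrite e0 normr0 (le_trans _ (spectral_radius_ge _ _ _ _ aP)).
pose u := v *m invmx P.
have vE : v = u *m P by rewrite /u mulmxKV// unitarymx_unit.
have -> : dotmx (v *m A') (v *m A') = dotmx (u *m diag_mx e) u.
  rewrite -(dotmx_unitary _ _ _ (u *m diag_mx e) u uP) -vE !dotmxE trmx_mul map_mxM A't mulmxA.
  by rewrite -[v *m A' *m _]mulmxA -/B BE /u !mulmxA.
have -> : dotmx v v = dotmx u u by rewrite vE dotmx_unitary.
have rho_ge0 : (0 < n)%N -> 0 <= rho.
  by move=> n0; have := e_le (Ordinal n0); rewrite -ler0c; apply: le_trans.
rewrite !dotmx_sum mulr_sumr; apply: ler_sum => i _.
have rho0 : 0 <= rho by apply/rho_ge0/(leq_ltn_trans (leq0n i)).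
rewrite /norm2 -/rho sqr_sqrtr//.
rewrite mul_mx_diag mxE mulrAC mulrC -normCK.
apply: ler_wpM2r; first by rewrite exprn_ge0.
(* The entries of [e] are real because [B] is Hermitian, so each is comparable with its modulus. *)
apply: le_trans (e_le i); apply: real_ler_norm.
exact: (mxOverP (hermitian_spectral_diag_real Bh)).
Qed.

(** The perturbation bound is taken as an inequality of squared lengths, so no operator norm over
    [C] has to be introduced. If every gap exceeded [delta], then in the basis [P] each nonzero
    coordinate of the eigenvector would be stretched by more than [delta]. *)
Lemma bauer_fike (C : numClosedFieldType) n (A P : 'M[C]_n) (d : 'rV[C]_n)
    (delta lambda : C) :
    P \is unitarymx -> 0 <= delta ->
    (forall v : 'rV[C]_n, let x := v *m (A - invmx P *m diag_mx d *m P) in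
      dotmx x x <= delta ^+ 2 * dotmx v v) ->
    eigenvalue A lambda ->
  exists i, `|lambda - d 0 i| <= delta.
Proof.
move=> uP delta0 le_delta /eigenvalueP[v vA v0].
have Pu := unitarymx_unit uP.
have [/existsP//|/existsPn far] := boolP [exists i, `|lambda - d 0 i| <= delta].
(* The order on [C] is partial; the negated inequality can be reversed because both sides are
   real. *)
have {}far i : delta < `|lambda - d 0 i|.
  by rewrite real_ltNge ?far// ?ger0_real.
pose u := v *m invmx P.
have vE : v = u *m P by rewrite /u mulmxKV.
have u0 : u != 0 by apply: contraNneq v0 => u0; rewrite vE u0 mul0mx.
clearbody u.
have := le_delta v; rewrite /= mulmxBr vA vE !mulmxA mulmxK//.
rewrite scalemxAl -mulmxBl !dotmx_unitary//.
suff lt : delta ^+ 2 * dotmx u u <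
    dotmx (lambda *: u - u *m diag_mx d) (lambda *: u - u *m diag_mx d).
  by move=> /(lt_le_trans lt); rewrite ltxx.
rewrite !dotmx_sum mulr_sumr.
have E j : (lambda *: u - u *m diag_mx d) 0 j = (lambda - d 0 j) * u 0 j.
  by rewrite mul_mx_diag !mxE mulrBl [u 0 j * _]mulrC.
have [i ui0] : exists i, u 0 i != 0 by apply/rV0Pn.
(* A nonzero coordinate of [u] supplies the strict inequality; the others contribute a weak one. *)
rewrite (bigD1 i)//= [ltRHS](bigD1 i)//=; apply: ltr_leD.
  rewrite E -!normCK normrM exprMn ltr_pM2r ?exprn_gt0 ?normr_gt0//.
  by rewrite ltrXn2r.
apply: ler_sum => j _.
rewrite E -!normCK normrM exprMn ler_wpM2r ?exprn_ge0//.
by rewrite lerXn2r ?nnegrE// ltW.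
Qed.

Lemma perm_mx_unitary (C : numClosedFieldType) n (s : 'S_n) :
  (perm_mx s : 'M[C]_n) \is unitarymx.
Proof.
apply/unitarymxP; rewrite tr_perm_mx map_perm_mx -perm_mxM.
by rewrite mulgV perm_mx1.
Qed.

Lemma conj_diag_exp (F : fieldType) n (P : 'M[F]_n) (d : 'rV[F]_n) k :
  P \in unitmx ->
  (invmx P *m diag_mx d *m P) ^+ k =
    invmx P *m diag_mx (map_mx (fun x => x ^+ k) d) *m P.
Proof.
move=> uP; elim: k => [|k IH].
  have -> : map_mx (fun x => x ^+ 0) d = const_mx 1.
    by apply/rowP => j; rewrite !mxE.
  by rewrite diag_const_mx mulmx1 mulVmx.
rewrite exprS IH; change (_ * _) with (invmx P *m diag_mx d *m P *m
    (invmx P *m diag_mx (map_mx (fun x => x ^+ k) d) *m P)).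
rewrite !mulmxA mulmxK// -[_ *m diag_mx _ *m diag_mx _]mulmxA mulmx_diag.
congr (_ *m diag_mx _ *m _); apply/rowP => j.
by rewrite !mxE exprS.
Qed.

Lemma perm_mx_exp (R : pzSemiRingType) n (s : 'S_n) k :
  (perm_mx s : 'M[R]_n) ^+ k = perm_mx (s ^+ k)%g.
Proof.
elim: k => [|k IH]; first by rewrite expg0 perm_mx1.
by rewrite exprS IH expgS perm_mxM.
Qed.

Lemma map_mx_exp (aR rR : pzRingType) (f : {rmorphism aR -> rR}) n
    (A : 'M[aR]_n) k :
  map_mx f (A ^+ k) = map_mx f A ^+ k.
Proof.
elim: k => [|k IH]; first exact: map_mx1.
by rewrite !exprS -IH; apply: map_mxM.
Qed.

Definition shift_perm n : 'S_n := perm (@ordS_inj n).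

Lemma shift_perm_exp n : (shift_perm n ^+ n = 1)%g.
Proof.
(* At [k = n] the residue of [i + n] is [i] itself. *)
have E k (i : 'I_n) : iter k (shift_perm n) i = ((i + k) %% n)%N :> nat.
  elim: k => [|k IH] /=; first by rewrite addn0 modn_small.
  by rewrite permE /= IH -[_.+1]addn1 modnDml addn1 addnS.
apply/permP => i; rewrite permX perm1; apply: val_inj.
by rewrite /= E modnDr modn_small.
Qed.

Lemma shift_mxE (R : realType) n : shift_mx R n = perm_mx (shift_perm n).
Proof. by apply/matrixP => i j; rewrite !mxE permE eq_sym. Qed.

(** De Moivre's formula at a negative angle, by induction from the addition formulas. *)
Lemma omega_exp (R : realType) n k :
  omega R n ^+ k = cos (2 * pi / n%:R *+ k) -i* sin (2 * pi / n%:R *+ k).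
Proof.
have -> : omega R n = cos (2 * pi / n%:R) -i* sin (2 * pi / n%:R).
  have -> : omega R n = cexp (0 -i* (2 * pi / n%:R)).
    by congr cexp; apply/eqP; rewrite eq_complex /=; apply/andP; split;
      apply/eqP; ring.
  by rewrite /cexp /= expR0 mul1r cosN sinN.
set x := 2 * pi / n%:R.
elim: k => [|k IH]; first by rewrite expr0 mulr0n cos0 sin0 oppr0.
rewrite exprS IH mulrS cosD sinD; rewrite [LHS]/GRing.mul /=; congr (_ +i* _); ring.
Qed.

(** By the half-angle formula [1 - cos x] is twice the square of [sin (x / 2)], and [x / 2] lies
    strictly between [0] and [pi]. *)
Lemma cos_lt1 (R : realType) (x : R) : 0 < x < 2 * pi -> cos x < 1.
Proof.
move=> /andP[x0 x2]; have -> : x = (x / 2) *+ 2 by rewrite -mulr_natr divfK.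
rewrite cos_mulr2n cos2sin2.
have : 0 < sin (x / 2) by apply: sin_gt0_pi; lra.
by move=> /(exprn_gt0 2); lra.
Qed.

Lemma omega_prim (R : realType) n : (0 < n)%N ->
  n.-primitive_root (omega R n).
Proof.
move=> n0; have nR : 0 < n%:R :> R by rewrite ltr0n.
rewrite /primitive_root_of_unity n0; apply/forallP => i.
rewrite unity_rootE omega_exp; apply/eqP.
case: (eqVneq i.+1 n) => [->|ni].
  have -> : 2 * pi / n%:R *+ n = pi *+ 2 :> R.
    by rewrite -mulr_natr divfK ?gt_eqF// mulr_natl.
  by rewrite cos2pi sin2pi oppr0 eqxx; apply/eqP.
(* For [i.+1 < n] the angle lies strictly between [0] and [2 * pi], so the real part alone already
   differs from 1. *)
apply/negbTE/eqP => -[/eqP + _]; rewrite lt_eqF// cos_lt1//.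
have iN : (i.+1 < n)%N by rewrite ltn_neqAle ni /=.
have pi0 := pi_gt0 R.
have -> : 2 * pi / n%:R *+ i.+1 = 2 * pi * (i.+1%:R / n%:R) :> R.
  by rewrite -mulr_natr mulrAC mulrA.
have tau0 : 0 < 2 * pi :> R by rewrite mulr_gt0.
rewrite (gtr_pMr _ tau0) ltr_pdivrMr// mul1r ltr_nat iN andbT.
by rewrite mulr_gt0// divr_gt0// ltr0Sn.
Qed.

Theorem theorem1 (R : realType) (h n : nat) (w : int -> R) (S : 'M[R]_n)
  (h_ge1 : (1 <= h)%N) (n_gt2h : (2 * h < n)%N)
  (w_sym : symmetric_filter h w)
  (S_smooth : smoothing_matrix h w S)
  (lambda : R[i])
  (lambda_eig : eigenvalue (map_mx (real_complex R) S) lambda) :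
  exists2 i : nat, (1 <= i <= n)%N &
    `| lambda
       - (\sum_(0 <= d < h.+1) (w d%:Z)%:C * omega R n ^+ ((i - 1) * d)
          + \sum_(1 <= k < h.+1)
              (w (- k%:Z))%:C * omega R n ^+ ((i - 1) * (n - k))) |
    <= (norm2 (S - circulant_mx n h w))%:C.
Proof.
have n_gt0 : (0 < n)%N by apply: leq_ltn_trans n_gt2h.
pose T : 'M[R[i]]_n := perm_mx (shift_perm n).
have Tn : T \is normalmx.
  have /unitarymxP TT := perm_mx_unitary R[i] n (shift_perm n).
  by apply/normalmxP; rewrite TT (mulmx1C TT).
pose P := spectralmx T; pose d := spectral_diag T.
have uP : P \is unitarymx := spectral_unitarymx T.
have Pu := unitarymx_unit uP.
have TE : T = invmx P *m diag_mx d *m P := orthomx_spectralP Tn.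
pose p (z : R[i]) := \sum_(0 <= k < h.+1) (w k%:Z)%:C * z ^+ k
  + \sum_(1 <= k < h.+1) (w (- k%:Z))%:C * z ^+ (n - k).
(* The spectral theorem lists the eigenvalues in no known order, so each is only located among the
   powers of [omega]: it is an [n]-th root of unity, and [omega] is primitive. *)
have dE i : exists2 k, (k < n)%N & d 0 i = omega R n ^+ k.
  have : T ^+ n = 1%:M by rewrite perm_mx_exp shift_perm_exp perm_mx1.
  rewrite {1}TE conj_diag_exp// => /(congr1 (fun M => P *m M *m invmx P)).
  rewrite !mulmxA mulmxV// mul1mx mulmxK// mulmx1 mulmxV//.
  move=> /matrixP/(_ i i); rewrite !mxE !eqxx !mulr1n => dn.
  by have [k ->] := prim_rootP (omega_prim R n n_gt0) dn; exists k.
have WE : map_mx (real_complex R) (circulant_mx n h w) =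
    invmx P *m diag_mx (map_mx p d) *m P.
  (* Additivity of [conjd] reduces the identity for the circulant matrix to single powers of the
     shift. *)
  pose conjd (v : 'rV[R[i]]_n) := invmx P *m diag_mx v *m P.
  have conjdD : {morph conjd : u v / u + v}.
    by move=> u v; rewrite /conjd raddfD/= mulmxDr mulmxDl.
  have conjd0 : conjd 0 = 0 by rewrite /conjd raddf0 mulmx0 mul0mx.
  have term (c : R) k : map_mx (real_complex R) (c *: shift_mx R n ^+ k) =
      conjd (c%:C *: map_mx (fun z => z ^+ k) d).
    rewrite map_mxZ map_mx_exp shift_mxE map_perm_mx -/T TE conj_diag_exp//.
    by rewrite /conjd linearZ/= -scalemxAr -scalemxAl.
  have -> : map_mx p d =
      \sum_(0 <= k < h.+1) (w k%:Z)%:C *: map_mx (fun z => z ^+ k) d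
      + \sum_(1 <= k < h.+1)
          (w (- k%:Z))%:C *: map_mx (fun z => z ^+ (n - k)) d.
    apply/rowP => j; rewrite !mxE !summxE.
    by congr (_ + _); apply: eq_bigr => k _; rewrite !mxE.
  rewrite -/(conjd _) conjdD !(big_morph conjd conjdD conjd0).
  rewrite /circulant_mx map_mxD; congr (_ + _);
    rewrite (big_morph _ (@map_mxD _ _ (real_complex R) n n) (map_mx0 _ n n));
    by apply: eq_bigr => k _; rewrite term.
have := @bauer_fike _ n _ P (map_mx p d)
  (norm2 (S - circulant_mx n h w))%:C lambda uP _ _ lambda_eig.
case=> [|v /=|i].
- by rewrite ler0c sqrtr_ge0.
- by rewrite -WE -map_mxB -rmorphXn; apply: dotmx_mulmx_norm2.
have [k kn dk] := dE i.
(* The index starts at 1 and enters the exponents as [i - 1], hence the witness [k.+1]. *)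
rewrite mxE dk => le_k; exists k.+1 => //; rewrite subn1 /=.
rewrite [X in lambda - X](_ : _ = p (omega R n ^+ k))//.
by congr (_ + _); apply: eq_bigr => j _; rewrite exprM.
Qed.
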